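(* Let $A$ be a non-degenerate three-dimensional evolution algebra over a field $\mathbb{K}$ with natural basis $\{e_1,e_2,e_3\}$ and $B:=\mathrm{Soc}(A)=\mathrm{span}(\{e_1,e_2+e_3\})$. Assume that $\mathrm{Soc}(A)$ does not have the extension property. If $A$ is indecomposable, then: (1) $B$ is an evolution algebra and there is a linear map $\varphi:B\to B$ and an element $b_0\in B$ such that $A\cong\mathrm{Adj}_2(B,\varphi,b_0,0)$. (2) $B$ is a minimal ideal of $A$; equivalently, the unique ideals of $B$ which are $\varphi$-invariant are $0$ and $B$ itself. (3) There is no $b\in B$ such that $\varphi=L_b$. The moduli set for this class of algebras is $(\mathrm{End}_{\mathbb{K}}(B)\times B)/\mathcal{G}$, where $\mathcal{G}=\mathrm{Aut}(B)\times B\times\mathbb{K}^\times$. Thus the isomorphism classes of algebras $\mathrm{Adj}_2(B,\varphi,b_0,0)$ (for fixed $B$) are in one-to-one correspondence with the elements of the set $(\mathrm{End}_{\mathbb{K}}(B)\times B)/\mathcal{G}$ of $\mathcal{G}$-orbits.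
   Context: An evolution algebra over $\mathbb{K}$ is a finite-dimensional (not necessarily associative) $\mathbb{K}$-algebra with a basis $\{e_i\}$ (a natural basis) with $e_ie_j=0$ for $i\ne j$; it is non-degenerate if $\mathrm{ann}(A)=\{x:xA=Ax=0\}=0$, equivalently $e_i^2\ne0$ for all $i$. $\mathrm{Soc}(A)$ is the sum of all minimal ideals $I$ of $A$ with $AI\ne\{0\}$. A subalgebra has the extension property if it has a natural basis that can be extended to a natural basis of $A$. An algebra is indecomposable if it is not a direct sum of two nonzero ideals. $L_b$ denotes left multiplication by $b$ in $B$; $\mathrm{End}_{\mathbb{K}}(B)$ is the space of linear maps $B\to B$; $\mathrm{Aut}(B)$ is the group of algebra automorphisms of $B$; $\mathbb{K}^\times=\mathbb{K}\setminus\{0\}$. For an evolution algebra $B$, a linear map $\varphi:B\to B$, $b_0\in B$ and $k_0\in\mathbb{K}$, $\mathrm{Adj}_2(B,\varphi,b_0,k_0)$ is the vector space $B\times\mathbb{K}$ with product $(b,\lambda)(b',\lambda')=(bb'+\lambda'\varphi(b)+\lambda\varphi(b')+\lambda\lambda'b_0,\ \lambda\lambda'k_0)$; $B$ is identified with the ideal $B\times\{0\}$. $\mathcal{G}=\mathrm{Aut}(B)\times B\times\mathbb{K}^\times$ has product $(\theta,b,k)(\theta',b',k')=(\theta\theta',\theta(b')+k'b,kk')$ and acts on $\mathrm{End}_{\mathbb{K}}(B)\times B$ by $(\theta,b,k)\cdot(\varphi,b_0)=(\varphi',b_0')$, where $\varphi'=k^{-1}(\theta\varphi\theta^{-1}-L_b)$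 and $b_0'=k^{-2}(\theta(b_0)-b^2-2k\varphi'(b))$. A moduli set for a class of algebras is a group acting on a set such that the isomorphism classes of algebras in the class are in one-to-one correspondence with the orbits.
   Formalization: Over imperfect fields of characteristic 2 the orbit correspondence is asserted only when one φ satisfies (2) and (3), or for isomorphisms preserving B, since it fails in general; the class of A is shown to inject into the set of orbits, not to fill it. *)

(* Defs.v *)
From HB Require Import structures.
From mathcomp Require Import all_boot all_order all_algebra.

Set Implicit Arguments.
Unset Strict Implicit.
Unset Printing Implicit Defensive.

Import GRing.Theory.
Local Open Scope ring_scope.

(* Algebras are finite-dimensional, not necessarily associative, commutative
   or unital: a vectType with a bilinear product. *)
Record algebra (K : fieldType) := Algebra {
  alg_space :> vectType K;
  amul : {bilinear alg_space -> alg_space -> alg_space}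
}.

Notation "x ** y" := (amul _ x y) (at level 40, left associativity) : ring_scope.

Section Algebras.
Variables (K : fieldType) (A : algebra K).
Implicit Types (I J U : {vspace A}) (X Y : seq A).

Definition ideal I : Prop :=
  forall a x : A, x \in I -> a ** x \in I /\ x ** a \in I.

Definition minimal_ideal I : Prop :=
  [/\ ideal I, I <> 0%VS &
      forall J, ideal J -> (J <= I)%VS -> J = 0%VS \/ J = I].

Definition non_degenerate : Prop :=
  forall x : A, (forall a : A, x ** a = 0 /\ a ** x = 0) -> x = 0.

(* v belongs to Soc(A), the sum of all minimal ideals I with AI <> {0};
   an element of a sum of a possibly infinite family of subspaces lies in the
   sum of finitely many of them. *)
Definition in_Soc (v : A) : Prop :=
  exists2 s : seq {vspace A},
    (forall I, I \in s ->
       minimal_ideal I /\ exists a x : A, x \in I /\ a ** x <> 0) &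
    v \in (\sum_(I <- s) I)%VS.

Definition is_Soc U : Prop := forall v : A, v \in U <-> in_Soc v.

Definition natural_basis U X : Prop :=
  basis_of U X /\
  (forall i j, (i < size X)%N -> (j < size X)%N -> i <> j ->
     X`_i ** X`_j = 0).

Definition is_evolution : Prop := exists X, natural_basis fullv X.

Definition extension_property U : Prop :=
  exists X Y, natural_basis U X /\ natural_basis fullv (X ++ Y).

Definition indecomposable : Prop :=
  ~ exists I J, [/\ ideal I, ideal J, I <> 0%VS, J <> 0%VS &
                    (I + J = fullv)%VS /\ (I :&: J = 0)%VS].

Definition lmul (b : A) : 'End(A) := linfun (amul A b).

End Algebras.

Arguments non_degenerate {K} A.
Arguments is_evolution {K} A.
Arguments indecomposable {K} A.

Definition alg_iso (K : fieldType) (A A' : algebra K) (f : 'Hom(A, A')) : Prop :=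
  bijective f /\ forall x y : A, f (x ** y) = f x ** f y.

Definition isomorphic (K : fieldType) (A A' : algebra K) : Prop :=
  exists f : 'Hom(A, A'), alg_iso f.

(* A subspace U seen as an algebra.  The projection onto U makes the product
   total; when U is a subalgebra of A it is the restricted product. *)
Section Subalgebra.
Variables (K : fieldType) (A : algebra K) (U : {vspace A}).

Definition sub_mul (x y : subvs_of U) : subvs_of U :=
  vsproj U (vsval x ** vsval y).

Fact sub_mul_bilinear : bilinear_for *:%R *:%R sub_mul.
Proof.
by split=> [y|x] a u v; rewrite /sub_mul !linearP // linearPl linearP.
Qed.

HB.instance Definition _ := bilinear_isBilinear.Build K
  (subvs_of U) (subvs_of U) (subvs_of U) *:%R *:%R sub_mul sub_mul_bilinear.

Definition subalg : algebra K :=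
  Algebra (sub_mul : {bilinear subvs_of U -> subvs_of U -> subvs_of U}).

End Subalgebra.

Section Adj2.
Variables (K : fieldType) (B : algebra K) (phi : 'End(B)) (b0 : B) (k0 : K).

Definition adj2_mul (x y : B * K^o) : B * K^o :=
  (x.1 ** y.1 + y.2 *: phi x.1 + x.2 *: phi y.1 + (x.2 * y.2) *: b0,
   x.2 * y.2 * k0).

Fact adj2_mul_bilinear : bilinear_for *:%R *:%R adj2_mul.
Proof.
split=> [[y m]|[x l]] a [u r] [v s]; rewrite /adj2_mul /=; congr pair => /=.
- rewrite linearPl linearP !scalerDr !scalerDl !scalerA.
  rewrite [m * a]mulrC mulrDl scalerDl -[a *: r]/(a * r) !mulrA.
  by rewrite [LHS](AC (2*2*2*2) ((1*3*5*7)*(2*4*6*8))).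
- by rewrite -![_ *: _]/(_ * _) !mulrDl !mulrA.
- rewrite linearP linearP !scalerDr !scalerDl !scalerA.
  rewrite [l * a]mulrC mulrDr scalerDl -[a *: r]/(a * r).
  rewrite [l * (a * r)]mulrCA !mulrA.
  by rewrite [LHS](AC (2*2*2*2) ((1*3*5*7)*(2*4*6*8))).
- rewrite -![_ *: _]/(_ * _) !mulrDr !mulrDl !mulrA.
  by rewrite [l * a]mulrC.
Qed.

HB.instance Definition _ := bilinear_isBilinear.Build K
  (B * K^o)%type (B * K^o)%type (B * K^o)%type *:%R *:%R
  adj2_mul adj2_mul_bilinear.

Definition Adj2 : algebra K :=
  Algebra (adj2_mul : {bilinear (B * K^o)%type -> (B * K^o)%type -> (B * K^o)%type}).

End Adj2.

Section ModuliGroup.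
Variables (K : fieldType) (B : algebra K).

(* The ambient type of triples (theta, b, k), and the group Aut(B) x B x K^*
   carved out of it. *)
Definition triple : Type := ('End(B) * B * K)%type.

Definition inG (g : triple) : Prop := alg_iso g.1.1 /\ g.2 != 0.

Definition gone : triple := (\1%VF, 0, 1).

Definition gmul (g h : triple) : triple :=
  ((g.1.1 \o h.1.1)%VF, g.1.1 h.1.2 + h.2 *: g.1.2, g.2 * h.2).

Definition ginv (g : triple) : triple :=
  ((g.1.1^-1)%VF, - (g.2^-1 *: (g.1.1^-1)%VF g.1.2), g.2^-1).

Definition gact (g : triple) (x : 'End(B) * B) : 'End(B) * B :=
  let: (theta, b, k) := g in
  let phi' := k^-1 *: ((theta \o x.1 \o theta^-1)%VF - lmul b) in
  (phi', k ^- 2 *: (theta x.2 - b ** b - (2%:R * k) *: phi' b)).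

Definition same_orbit (x y : 'End(B) * B) : Prop :=
  exists2 g, inG g & gact g x = y.

Lemma aut_linvK (theta : 'End(B)) :
  alg_iso theta -> cancel theta (theta^-1)%VF /\ cancel (theta^-1)%VF theta.
Proof.
move=> [bij _]; have k0 : lker theta == 0%VS by apply/lker0P/bij_inj.
by split; [apply: lker0_lfunK | apply: lker0_lfunVK].
Qed.

Lemma inG_one : inG gone.
Proof.
split; last exact: oner_neq0.
by split=> [|x y]; rewrite ?id_lfunE //; exists id => x; rewrite id_lfunE.
Qed.

Lemma inG_mul g h : inG g -> inG h -> inG (gmul g h).
Proof.
move=> [[bg mg] kg] [[bh mh] kh]; split; last by rewrite mulf_neq0.
split=> [|x y]; last by rewrite !comp_lfunE mh mg.
by apply: (eq_bij (bij_comp bg bh)) => x /=; rewrite comp_lfunE.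
Qed.

Lemma inG_inv g : inG g -> inG (ginv g).
Proof.
move=> [ag kg]; have [K1 K2] := aut_linvK ag; split; last by rewrite invr_eq0.
split=> [|x y]; first by exists g.1.1.
by apply: (can_inj K1); rewrite ag.2 !K2.
Qed.

Lemma gmulA : associative (@gmul).
Proof.
move=> [[t b] k] [[t' b'] k'] [[t'' b''] k'']; rewrite /gmul /=.
by rewrite comp_lfunA mulrA comp_lfunE linearD linearZ scalerDr scalerA
  -addrA [k' * k'']mulrC.
Qed.

Lemma gmul1 : left_id gone gmul.
Proof.
by move=> [[t b] k]; rewrite /gmul /gone /= comp_lfun1l id_lfunE scaler0 addr0 mul1r.
Qed.

Lemma gmulV g : inG g -> gmul (ginv g) g = gone.
Proof.
move=> [ag kg]; have [K1 _] := aut_linvK ag.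
rewrite /gmul /gone /= scalerN scalerA mulfV // scale1r subrr mulVf //.
by congr (_, _, _); apply/lfunP => x; rewrite comp_lfunE K1 id_lfunE.
Qed.

Lemma gact1 x : gact gone x = x.
Proof.
case: x => phi b0; rewrite /gact /gone.
have -> : lmul (0 : B) = 0.
  by apply/lfunP => y; rewrite lfunE /= linear0l zero_lfunE.
have V : (\1^-1)%VF = \1%VF :> 'End(B).
  apply/lfunP => y; have [K1 _] := aut_linvK inG_one.1.
  by rewrite -[RHS]K1 !id_lfunE.
rewrite V comp_lfun1l comp_lfun1r subr0 invr1 expr1n invr1 !scale1r /=.
by rewrite id_lfunE linear0l !subr0 linear0 scaler0 subr0.
Qed.

Lemma gactM g h x : (forall a b : B, a ** b = b ** a) ->
  inG g -> inG h -> gact (gmul g h) x = gact g (gact h x).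
Proof.
move=> mC gG hG; have ghG := inG_mul gG hG.
have [Kg1 Kg2] := aut_linvK gG.1; have [Kh1 Kh2] := aut_linvK hG.1.
have [Kgh1 Kgh2] := aut_linvK ghG.1.
case: g h x gG hG ghG Kg1 Kg2 Kh1 Kh2 Kgh1 Kgh2
  => [[t b] k] [[t' b'] k'] [phi b0] [[_ mt] k0] [_ k'0] _.
rewrite /= in mt k0 k'0 *; move=> Kg1 Kg2 Kh1 Kh2 Kgh1 Kgh2.
have V y : ((t \o t')^-1)%VF y = (t'^-1)%VF ((t^-1)%VF y).
  by apply: (can_inj Kgh1); rewrite Kgh2 comp_lfunE Kh2 Kg2.
set p1 := _ *: _; set p2 := k'^-1 *: _; set p3 := k^-1 *: _.
have tB u v : t (u - v) = t u - t v by rewrite linearB.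
have tZ a u : t (a *: u) = a *: t u by rewrite linearZ.
have P2 y : p2 y = k'^-1 *: (t' (phi ((t'^-1)%VF y)) - b' ** y).
  by rewrite scale_lfunE add_lfunE opp_lfunE !comp_lfunE [lmul _ _]lfunE.
have P3 y : p3 y = k^-1 *: (t (p2 ((t^-1)%VF y)) - b ** y).
  by rewrite scale_lfunE add_lfunE opp_lfunE !comp_lfunE [lmul _ _]lfunE.
have E : p1 = p3.
  apply/lfunP => y; rewrite P3 P2 scale_lfunE add_lfunE opp_lfunE !comp_lfunE V.
  rewrite [lmul _ _]lfunE /= linearDl linearZl_LR /= tZ tB mt Kg2.
  rewrite invfM -scalerA; congr (_ *: _).
  rewrite opprD addrA scalerBr scalerBr; congr (_ - _).
  by rewrite scalerA mulVf // scale1r.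
rewrite E; congr pair; rewrite comp_lfunE /= exprMn invfM -scalerA.
congr (_ *: _); rewrite tZ !tB tZ mt.
have -> : p3 (t b' + k' *: b) = p3 (t b') + k' *: p3 b.
  by rewrite linearD linearZ.
have -> : t (p2 b') = k *: p3 (t b') + b ** t b'.
  by rewrite P3 Kg1 scalerA mulfV // scale1r subrK.
rewrite [(_ + _) ** (_ + _)]linearDl !linearDr !linearZl_LR !linearZr_LR /=.
rewrite [t b' ** b]mC; set P := p3 (t b'); set Q := p3 b.
set T := t (t' b0); set U := t b' ** t b'; set W := b ** t b'; set Z := b ** b.
have -> v : v - Z - (2 * k) *: Q
    = v - k' ^- 2 *: (k' ^+ 2 *: Z + (k' ^+ 2 * (2 * k)) *: Q).
  rewrite scalerDr !scalerA [_ * (_ * (2 * k))]mulrA mulVf ?expf_neq0 //.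
  by rewrite mul1r scale1r opprD addrA.
rewrite -scalerBr; congr (_ *: _).
rewrite !scalerDr !scalerA -expr2 -!addrA; congr (_ + _).
rewrite -!opprD; congr (- _); rewrite -!addrA; congr (_ + _).
have -> : 2 * k' * k = 2 * (k * k') by rewrite -mulrA [k' * k]mulrC.
have -> : k' ^+ 2 * (2 * k) = 2 * (k * k') * k'.
  by rewrite expr2 !mulrA (AC 4 (3*4*1*2)).
rewrite [2 * k']mulr_natl mulr2n scalerDl.
by rewrite [LHS](AC (1*(1*(1*(1*1)))) (4*((1*2)*(3*5)))).
Qed.

End ModuliGroup.

Section Classification.
Variables (K : fieldType) (B : algebra K).

Definition Adj2_0 (x : 'End(B) * B) : algebra K := Adj2 x.1 x.2 0.

Definition no_invariant_ideal (phi : 'End(B)) : Prop :=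
  forall J : {vspace B}, ideal J -> (phi @: J <= J)%VS -> J = 0%VS \/ J = fullv.

Definition not_left_mul (phi : 'End(B)) : Prop := ~ exists b : B, phi = lmul b.

Definition admissible (x : 'End(B) * B) : Prop :=
  no_invariant_ideal x.1 /\ not_left_mul x.1.

(* The non-degenerate indecomposable three-dimensional evolution algebras whose
   socle is span(e1, e2 + e3) for some natural basis, lacks the extension
   property, and is isomorphic to B. *)
Definition socle_class (A : algebra K) : Prop :=
  exists e1 e2 e3 : A,
    let S := <<[:: e1; (e2 + e3)%R]>>%VS in
    [/\ natural_basis fullv [:: e1; e2; e3], non_degenerate A, is_Soc S,
        ~ extension_property S & indecomposable A /\ isomorphic (subalg S) B].

(* f maps the ideal B x {0} onto the ideal B x {0}, when f is bijective. *)
Definition preserves_B (x y : 'End(B) * B) (f : 'Hom(Adj2_0 x, Adj2_0 y)) : Prop :=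
  forall c : (B * K^o)%type, (f c).2 = 0 <-> c.2 = 0.

End Classification.

(* K is not an imperfect field of characteristic 2.  Over an imperfect one an
   isomorphism between two algebras Adj2 B phi b0 0 need not come from the
   group: let t be a non-square and let B have natural basis e, u with
   e^2 = u^2 = e + u =: l (so l^2 = 0).  Then span(l, e + (0,1)) is an ideal of
   Adj2 B 0 ((1+t)l) 0 isomorphic to B, with complement (1+t)l + (0,1), which
   gives Adj2 B 0 ((1+t)l) 0 ~ Adj2 B 0 ((1+t)/t l) 0; but every automorphism of
   B fixes l, so (0, (1+t)l) and (0, (1+t)/t l) lie in different orbits.  This B
   is the socle of the algebra with natural basis e1, e2, e3 and
   e1^2 = e1 + e2 + e3, e2^2 = e1, e3^2 = e2 + e3 (u = e2 + e3). *)
Definition not_imperfect_char2 (K : fieldType) : Prop :=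
  (2 : K) != 0 \/ forall x : K, exists y : K, y ^+ 2 = x.

(* Main.v *)
From HB Require Import structures.
Require Import Defs.
From mathcomp Require Import all_boot all_order all_algebra.
From mathcomp Require Import ring.
Set Implicit Arguments.
Unset Strict Implicit.
Unset Printing Implicit Defensive.
Import GRing.Theory.
Local Open Scope ring_scope.

(** Write u = e2 + e3.  The plane S spanned by e1 and u is an ideal, being a
    sum of ideals, so it contains e1 e1, e2 u = e2 e2 and e3 u = e3 e3, hence all
    products of A.  As e2 is not in S, the algebra A is recovered from B = S, the
    map phi : b |-> e2 b and the element b0 = e2 e2 ([codim1_adj2]).

    If S contained a smaller nonzero ideal J, some minimal ideal I of the socle
    would not lie in J, and then I and J meet in 0 by minimality.  An ideal in S
    holding a vector with both coordinates nonzero contains e_i e_i for all i,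
    and then meets every other nonzero ideal of S; so one of I, J is the line of
    e1 and the other the line of u, and A is the direct sum of the ideals <e1>
    and <e2, e3> ([socle_minimal]).  If phi were the left
    multiplication by b, then e2 - b would annihilate S and complete {e1, u} to a
    natural basis of A ([socle_not_left_mul]).

    An isomorphism between two algebras Adj2(B, ., ., 0) that preserves B has
    the form (c, r) |-> (theta c + r d, k r), and comparing products turns this
    triple (theta, d, k) into an element of the group moving one pair to the
    other ([orbit_iso], [iso_orbit]).  So all that remains is to see when an
    isomorphism f preserves B.  The preimage of B under f contains every product,
    so its trace on B is an ideal that is stable under phi and not zero; when B
    has no proper ideal of that kind, f preserves B ([admissible_preserves]).

    For arbitrary phi the preimage J of B can differ from the plane H = B x 0.
    All products then lie on the line H n J = <l>, so the algebra is a symmetric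
    bilinear form with values in l, and the algebras H and J are isomorphic.  A
    Witt-type extension argument yields an automorphism carrying H onto J
    ([swap_hyperplanes]); composing f with it gives an isomorphism that preserves
    B.  The extension amounts to a few equations in the field
    ([similitude_solution]); their solution divides by 2 or takes a square root
    in characteristic 2. *)

(** * Products and isomorphisms *)

Section Products.
Variables (K : fieldType) (A : algebra K).
Implicit Types x y z : A.

Lemma amulDl x y z : (x + y) ** z = x ** z + y ** z.
Proof. exact: linearDl. Qed.
Lemma amulDr x y z : z ** (x + y) = z ** x + z ** y.
Proof. exact: linearD. Qed.
Lemma amulBl x y z : (x - y) ** z = x ** z - y ** z.
Proof. exact: linearBl. Qed.
Lemma amulBr x y z : z ** (x - y) = z ** x - z ** y.
Proof. exact: linearB. Qed.
Lemma amulZl a x y : (a *: x) ** y = a *: (x ** y).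
Proof. exact: linearZl_LR. Qed.
Lemma amulZr a x y : x ** (a *: y) = a *: (x ** y).
Proof. exact: linearZ. Qed.
Lemma amul0l y : 0 ** y = 0 :> A.
Proof. exact: linear0l. Qed.
Lemma amul0r y : y ** 0 = 0 :> A.
Proof. exact: linear0. Qed.

Lemma amul_suml I (r : seq I) (F : I -> A) y :
  (\sum_(i <- r) F i) ** y = \sum_(i <- r) F i ** y.
Proof. exact: linear_sumlz. Qed.
Lemma amul_sumr I (r : seq I) (F : I -> A) y :
  y ** (\sum_(i <- r) F i) = \sum_(i <- r) y ** F i.
Proof. exact: linear_sum. Qed.

Definition amulE :=
  (amulDl, amulDr, amulBl, amulBr, amulZl, amulZr, amul0l, amul0r).

Lemma lmulE b x : lmul b x = b ** x.
Proof. by rewrite lfunE. Qed.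

Lemma natural_basis_commutative (X : seq A) :
  natural_basis fullv X -> forall x y, x ** y = y ** x.
Proof.
move=> [/andP[/eqP spanX _] orthX] x y.
have /(@coord_span _ _ _ (in_tuple X)) -> : x \in <<X>>%VS by rewrite spanX memvf.
have /(@coord_span _ _ _ (in_tuple X)) -> : y \in <<X>>%VS by rewrite spanX memvf.
rewrite amul_suml [RHS]amul_sumr /=; apply: eq_bigr => i _.
rewrite amul_sumr [RHS]amul_suml /=; apply: eq_bigr => j _.
rewrite !amulE scalerA mulrC -scalerA; congr (_ *: (_ *: _)).
have [<- // | /eqP ij] := eqVneq i j.
have ijN : i <> j :> nat by move/val_inj.
by rewrite !orthX //; apply/nesym.
Qed.

End Products.

Section Isomorphisms.
Variable K : fieldType.
Implicit Types A B C : algebra K.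

Lemma linear_lfun (U V : vectType K) (f : U -> V) :
  linear f -> exists g : 'Hom(U, V), g =1 f.
Proof.
move=> fL; pose fM := GRing.isLinear.Build K U V _ f fL.
pose h : {linear U -> V} := HB.pack f fM.
by exists (linfun h) => x; rewrite lfunE.
Qed.

Lemma alg_iso_inv A B (f : 'Hom(A, B)) : alg_iso f ->
  exists2 g : 'Hom(B, A), alg_iso g & cancel f g /\ cancel g f.
Proof.
move=> [[g fK gK] fM].
have gL : linear g.
  by move=> a u v; apply: (can_inj fK); rewrite gK linearP /= !gK.
have [h hE] := linear_lfun gL.
have fhK : cancel f h by move=> x; rewrite hE.
have hfK : cancel h f by move=> x; rewrite hE.
exists h => //; split; first by exists f.
by move=> x y; apply: (can_inj fhK); rewrite hfK fM !hfK.
Qed.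

Lemma alg_iso_comp A B C (g : 'Hom(B, C)) (f : 'Hom(A, B)) :
  alg_iso g -> alg_iso f -> alg_iso (g \o f)%VF.
Proof.
move=> [gb gM] [fb fM]; split=> [|x y]; last by rewrite !comp_lfunE fM gM.
by apply: (eq_bij (bij_comp gb fb)) => x /=; rewrite comp_lfunE.
Qed.

Lemma isomorphic_trans A B C :
  isomorphic A B -> isomorphic B C -> isomorphic A C.
Proof. by move=> [f fI] [g gI]; exists (g \o f)%VF; apply: alg_iso_comp. Qed.

End Isomorphisms.

(** * Maps between double adjunctions *)

Section AdjunctionMaps.
Variable K : fieldType.
Implicit Types B C : algebra K.

Lemma adj2E B (phi : 'End(B)) b0 (x y : Adj2 phi b0 0) :
  x ** y = (x.1 ** y.1 + y.2 *: phi x.1 + x.2 *: phi y.1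
              + (x.2 * y.2) *: b0, 0) :> Adj2 phi b0 0.
Proof. by rewrite /amul /= /adj2_mul mulr0. Qed.

(** The two hypotheses on theta are what comparing the products (c, 0)(0, 1) and
    (0, 1)(0, 1) with those of their images gives.  The two bases may differ so
    that the same map also transports a structure along B ~ C (d = 0, k = 1). *)
Lemma adj2_iso B C (phi : 'End(B)) b0 (psi : 'End(C)) c0
    (theta : 'Hom(B, C)) (d : C) (k : K) :
    (forall a b : C, a ** b = b ** a) -> alg_iso theta -> k != 0 ->
    (forall c, theta (phi c) = d ** theta c + k *: psi (theta c)) ->
    theta b0 = d ** d + (2 * k) *: psi d + k ^+ 2 *: c0 ->
  exists f : 'Hom(Adj2 phi b0 0, Adj2 psi c0 0),
    alg_iso f /\ forall c, f c = (theta c.1 + c.2 *: d, k * c.2).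
Proof.
move=> mC [[eta tK eK] tM] k0 Hphi Hb0.
pose F (c : B * K^o) : C * K^o := (theta c.1 + c.2 *: d, k * c.2).
have FL : linear F.
  move=> a [u r] [v s]; rewrite /F; congr pair => /=.
    by rewrite linearP scalerDl scalerDr -scalerA addrACA.
  by rewrite mulrDr -[a *: r]/(a * r) -[X in _ = X + _]/(a * (k * r)) mulrCA.
have [f fE] := @linear_lfun K (B * K^o)%type (C * K^o)%type F FL.
exists f; split=> //; split.
  exists (fun c : C * K^o => (eta (c.1 - (k^-1 * c.2) *: d), k^-1 * c.2)).
    move=> [c r]; rewrite fE /F /= mulKf //; congr pair.
    by rewrite addrK tK.
  by move=> [c r]; rewrite fE /F /= eK mulVKf // subrK.
move=> [c r] [c' s]; rewrite !fE /F /= !adj2E /=; congr (_, _); last by rewrite !mulr0.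
rewrite mulr0 scale0r addr0 !linearD !linearZ /= tM !Hphi Hb0 !amulE.
rewrite [theta c ** d]mC !scalerDr !scalerA.
have -> : r * s * (2 * k) = k * s * r + k * r * s by ring.
have -> : r * s * k ^+ 2 = k * r * (k * s) by ring.
rewrite scalerDl [r * k]mulrC [s * k]mulrC.
rewrite [s * r]mulrC [r * (k * s)]mulrC [s * (k * r)]mulrC.
by rewrite [LHS](AC (1*2*2*(1*2*1)) (1*4*(2*6)*(3*7)*(5*8)*9)).
Qed.

End AdjunctionMaps.

(** * Orbits and isomorphisms that preserve the base *)

Section Orbits.
Variables (K : fieldType) (B : algebra K).
Hypothesis mC : forall a b : B, a ** b = b ** a.
Implicit Types x y : 'End(B) * B.

Lemma orbit_iso x y : same_orbit x y ->
  exists f : 'Hom(Adj2_0 x, Adj2_0 y), alg_iso f /\ preserves_B f.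
Proof.
case: x => phi b0; case: y => psi c0 [[[theta b] k] [/= tI k0] [Hpsi Hc0]].
have [tK tVK] := aut_linvK tI.
have psiE v : k *: psi v = theta (phi ((theta^-1)%VF v)) - b ** v.
  rewrite -Hpsi scale_lfunE scalerA mulfV // scale1r.
  by rewrite add_lfunE opp_lfunE !comp_lfunE lmulE.
have Hphi c : theta (phi c) = b ** theta c + k *: psi (theta c).
  by rewrite psiE tK addrC subrK.
have Hb0 : theta b0 = b ** b + (2 * k) *: psi b + k ^+ 2 *: c0.
  rewrite -Hc0 Hpsi scalerA mulfV ?expf_neq0 // scale1r.
  by rewrite [RHS]addrC [b ** b + _]addrC addrA !subrK.
have [f0 [fI fE]] := adj2_iso mC tI k0 Hphi Hb0.
exists f0; split=> // c; rewrite fE /=; split=> [/eqP|->]; last by rewrite mulr0.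
by rewrite mulf_eq0 (negPf k0) => /eqP.
Qed.

(** The group element is read off the images of (c, 0) and (0, 1): the former is
    (theta c, 0) because B is preserved, the latter is (d, k). *)
Lemma iso_orbit x y (f : 'Hom(Adj2_0 x, Adj2_0 y)) :
  alg_iso f -> preserves_B f -> same_orbit x y.
Proof.
case: x f => phi b0; case: y => psi c0 f fI fB.
have [_ fM] := fI.
have [g _ [fK gK]] := alg_iso_inv fI.
pose T (c : B) : B := (f (c, 0)).1.
have TL : linear T.
  move=> a u v; have -> : (T (a *: u + v)) = (f (a *: (u, 0) + (v, 0))).1.
    by congr (f _).1; congr (_, _); rewrite /= [a *: 0]scaler0 addr0.
  by rewrite linearP.
have [theta thE] := linear_lfun TL.
have f0E c : f (c, 0) = (theta c, 0).
  rewrite thE /T; case E: (f _) => [u r].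
  by have /fB := erefl (c, 0 : K).2; rewrite E /= => ->.
pose d : B := (f (0, 1)).1; pose k : K := (f (0, 1)).2.
have k0 : k != 0.
  by apply/eqP => /fB /= /eqP; rewrite oner_eq0.
have f1E : f (0, 1) = (d, k) by exact: surjective_pairing.
have thM p q : theta (p.1 ** q.1 + q.2 *: phi p.1 + p.2 *: phi q.1 + (p.2 * q.2) *: b0)
    = (f p).1 ** (f q).1 + (f q).2 *: psi (f p).1 + (f p).2 *: psi (f q).1
        + ((f p).2 * (f q).2) *: c0.
  rewrite thE /T.
  have E := etrans (congr1 f (esym (adj2E p q)))
                   (etrans (fM p q) (adj2E (f p) (f q))).
  exact (congr1 fst E).
have tI : alg_iso theta.
  split.
    exists (fun c => (g (c, 0)).1) => c.
      exact: etrans (congr1 (fun z => (g z).1) (esym (f0E c))) (congr1 fst (fK (c, 0))).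
    have gc0 : (g (c, 0)).2 = 0 := (fB _).1 (congr1 snd (gK (c, 0))).
    have gE : g (c, 0) = ((g (c, 0)).1, 0) by move: gc0; case: (g (c, 0)) => u r /= ->.
    exact: etrans (thE _) (congr1 fst (etrans (congr1 f (esym gE)) (gK (c, 0)))).
  move=> u v; have := thM (u, 0) (v, 0); rewrite (f0E u) (f0E v) /=.
  by rewrite !mulr0 !scale0r !addr0.
have [tK tVK] := aut_linvK tI.
have Hphi c : theta (phi c) = d ** theta c + k *: psi (theta c).
  have := thM (c, 0) (0, 1); rewrite (f0E c) f1E /=.
  rewrite !linear0 !(mul0r, scale0r, scale1r) !(addr0, add0r).
  by rewrite [d ** _]mC.
have Hb0 : theta b0 = d ** d + (2 * k) *: psi d + k ^+ 2 *: c0.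
  have := thM (0, 1) (0, 1); rewrite f1E /=.
  rewrite !linear0 mulr1 !scale1r !(addr0, add0r) => ->.
  by rewrite expr2 mulr_natl mulr2n scalerDl addrA.
have psiE : k^-1 *: ((theta \o phi \o theta^-1)%VF - lmul d) = psi.
  apply/lfunP => v; rewrite scale_lfunE add_lfunE opp_lfunE !comp_lfunE lmulE.
  by rewrite Hphi tVK addrC addKr scalerA mulVf // scale1r.
exists (theta, d, k) => //.
rewrite /gact /= psiE; congr (_, _).
rewrite Hb0 -[X in _ *: X]addrA -opprD addrAC addrN add0r.
by rewrite scalerA mulVf ?expf_neq0 // scale1r.
Qed.

(** Products of the target have last coordinate 0.  So the kernel of the last
    coordinate of f on B contains all products of B and all values of phi:
    it is an invariant ideal, nonzero since B has a nonzero product, hence B. *)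
Lemma admissible_preserves x y (f : 'Hom(Adj2_0 x, Adj2_0 y)) :
    (exists u v : B, u ** v <> 0) -> no_invariant_ideal x.1 ->
  alg_iso f -> preserves_B f.
Proof.
move=> [u [v uv0]] simple_x [fb fM].
have prod_in p q : (f (p ** q)).2 = 0.
  exact: etrans (congr1 snd (fM p q)) (congr1 snd (adj2E (f p) (f q))).
pose T (c : B) : K^o := (f (c, 0)).2.
have TL : linear T.
  move=> a s t; rewrite /T; have -> : (a *: s + t, 0) = a *: (s, 0) + (t, 0) :> B * K^o.
    by congr (_, _); rewrite /= [a *: 0]scaler0 addr0.
  by rewrite linearP.
have [h hE] := linear_lfun TL.
have mulJ a c : h (a ** c) = 0.
  rewrite hE /T; have := prod_in (a, 0) (c, 0).
  by rewrite adj2E /= mulr0 !scale0r !addr0.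
have phiJ c : h (x.1 c) = 0.
  rewrite hE /T; have := prod_in (c, 0) (0, 1).
  by rewrite adj2E /= amul0r mul0r !scale0r !addr0 add0r scale1r.
have [||kerE|kerE] := simple_x (lker h).
- by move=> a c _; rewrite !memv_ker !mulJ.
- by apply/subvP => _ /memv_imgP[c _ ->]; rewrite memv_ker phiJ.
- by case: uv0; apply/eqP; rewrite -memv0 -kerE memv_ker mulJ.
have f0 c : (f (c, 0)).2 = 0.
  by apply/eqP; rewrite -[X in X == _]hE -memv_ker kerE memvf.
have f2 p : (f p).2 = p.2 *: (f (0, 1)).2 :> K^o.
  have -> : f p = f ((p.1, 0) + p.2 *: (0, 1)).
    congr (f _); case: p => c r.
    by congr (_, _); rewrite /= ?scaler0 ?addr0 // add0r [_ *: 1]mulr1.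
  by rewrite linearD linearZ /= f0 add0r.
have [g gK fK] := fb.
have k0 : (f (0, 1)).2 != 0.
  apply/eqP => k0.
  have := etrans (esym (f2 (g (0, 1)))) (congr1 snd (fK (0, 1))).
  by rewrite k0 scaler0 /= => /eqP; rewrite eq_sym oner_eq0.
move=> p; rewrite f2; split=> [/eqP|->]; last by rewrite scale0r.
by rewrite scaler_eq0 (negPf k0) orbF => /eqP.
Qed.

End Orbits.

(** * Moving one hyperplane onto another *)

(** The equations say that l |-> d l, m1 |-> m2 + z l, m2 |-> x m1 + y m2 + w l
    respects products when l l = n l, l m1 = l m2 = p l, m1 m1 = s l,
    m1 m2 = t l, m2 m2 = c s l.  For c = 1 exchange m1 and m2.  Otherwise n = 0.
    If p = 0 then l annihilates everything, and l |-> c l, m1 |-> m2, m2 |-> c m1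
    does.  If p <> 0 and 2 is invertible, adding a multiple of l to m1 or m2
    adjusts its square, so that they can be exchanged after such a correction; in
    characteristic 2 the square of m_i + z l is that of m_i, and c must be absorbed
    by its square root. *)
Lemma similitude_solution (K : fieldType) (c n p s t : K) :
    not_imperfect_char2 K -> c != 0 -> n = c * n ->
  exists d x y z w, [/\ d != 0, x != 0,
    [/\ n * d = d * d * n, p * d = d * p + d * z * n
      & p * d = d * x * p + d * y * p + d * w * n] &
    [/\ s * d = c * s + 2 * z * p + z * z * n,
        t * d = x * t + y * (c * s) + w * p + z * (x * p + y * p + w * n)
      & c * s * d = x * x * s + y * y * (c * s) + w * w * n
          + 2 * (x * y * t + x * w * p + y * w * p)]].
Proof.
move=> perf c0 nc.
have [-> | c1] := eqVneq c 1.
  by exists 1, 1, 0, 0, 0; rewrite oner_eq0; split=> //; split; ring.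
have -> : n = 0.
  apply/eqP; move/eqP: nc; rewrite -subr_eq0 -[X in X - _]mul1r -mulrBl mulf_eq0.
  by rewrite subr_eq0 eq_sym (negPf c1).
have [-> | p0] := eqVneq p 0.
  by exists c, c, 0, 0, 0; split=> //; split; ring.
have [two0 | two0] := eqVneq (2 : K) 0; last first.
  pose z := (s - c * s) / (2 * p).
  exists 1, 1, 0, z, (- z); rewrite oner_eq0.
  by split=> //; split; rewrite /z; field; rewrite ?p0 ?two0.
have [/eqP // | sq] := perf; have [x xx] := sq c.
exists c, x, (1 - x), 0, ((c * t - x * t - (1 - x) * (c * s)) / p).
rewrite c0; split=> //.
- by apply: contraNneq c0 => x0; rewrite -xx x0 expr0n.
- by split; ring.
- split; [ring | by field |].
  set w := _ / p.
  (* The correction terms vanish: x is a square root of c, and 2 = 0. *)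
  have -> : x * x * s + (1 - x) * (1 - x) * (c * s) + w * w * 0
      + 2 * (x * (1 - x) * t + x * w * p + (1 - x) * w * p)
    = c * s * c + (x ^+ 2 - c) * (s + c * s)
      + 2 * (c * s - x * c * s + (x * (1 - x) * t + x * w * p + (1 - x) * w * p)).
    by ring.
  by rewrite xx subrr two0 !mul0r !addr0.
Qed.

Section Hyperplanes.
Variables (K : fieldType) (A : algebra K).
Implicit Types x y l m : A.

(** Only the products of pairs of basis vectors have to be compared, and by
    commutativity each pair once. *)
Lemma basis_map_iso (X Y : 3.-tuple A) :
    basis_of fullv X -> basis_of fullv Y ->
    (forall x y, x ** y = y ** x) ->
    (forall g : 'End(A), (forall i : 'I_3, g X`_i = Y`_i) ->
       forall i j : 'I_3, (i <= j)%N -> g (X`_i ** X`_j) = Y`_i ** Y`_j) ->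
  exists g : 'End(A), alg_iso g /\ forall i : 'I_3, g X`_i = Y`_i.
Proof.
move=> /[dup] /basis_free freeX /span_basis spanX /span_basis spanY mC tab.
have [g0 g0E] := linear_of_free X Y.
pose g := linfun g0.
have gX : map g X = Y.
  by rewrite -[RHS]g0E ?size_tuple //; apply: eq_map => x; rewrite lfunE.
have gE (i : 'I_3) : g X`_i = Y`_i.
  by rewrite -gX (nth_map 0) ?size_tuple.
have gfull : (g @: fullv)%VS = fullv by rewrite -spanX limg_span gX spanY.
have gker : lker g == 0%VS.
  have := limg_ker_dim g fullv; rewrite gfull capfv => /eqP.
  by rewrite -[X in _ == X]add0n eqn_add2r dimv_eq0.
exists g; split=> //; split.
  by exists (g^-1)%VF; [apply: lker0_lfunK | apply: lker0_lfunVK].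
move=> x y.
have gM (i j : 'I_3) : g (X`_i ** X`_j) = g X`_i ** g X`_j.
  rewrite !gE; case: (leqP i j) => ij; first exact: tab.
  by rewrite mC tab ?(ltnW ij) // mC.
have gMy (i : 'I_3) : g (X`_i ** y) = g X`_i ** g y.
  have /coord_span -> : y \in <<X>>%VS by rewrite spanX memvf.
  rewrite !linear_sum /=; apply: eq_bigr => j _ /=.
  by rewrite !linearZ /= gM.
have /coord_span -> : x \in <<X>>%VS by rewrite spanX memvf.
rewrite amul_suml !linear_sum /= amul_suml; apply: eq_bigr => i _ /=.
by rewrite !amulE !linearZ /= gMy amulE.
Qed.

Lemma basis3 (l m1 m2 : A) : \dim {:A} = 3%N ->
  l != 0 -> m1 \notin <[l]>%VS -> m2 \notin (<[l]> + <[m1]>)%VS ->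
  basis_of fullv [:: l; m1; m2].
Proof.
move=> d3 l0 m1l m2lm; rewrite basisEfree d3 leqnn subvf andbT.
rewrite -(@perm_free _ _ [:: m2; m1; l]); last first.
  by rewrite -[X in perm_eq X _]/(rev [:: l; m1; m2]) perm_rev.
rewrite !free_cons nil_free span_nil memv0 l0 span_seq1 m1l !andbT.
by rewrite span_cons span_seq1 addvC.
Qed.

(** Isomorphic planes that contain all products are conjugate under automorphisms,
    although psi itself need not extend to one.  With l spanning the intersection
    of the planes, m1 in H off that line and m2 = psi m1, the vectors l, m1, m2
    form a basis; psi l = c l since l is a product, and applying psi to the
    products in H gives the table that [similitude_solution] takes. *)
Lemma swap_hyperplanes (H : {vspace A}) (psi : 'End(A)) :
    not_imperfect_char2 K -> (forall x y, x ** y = y ** x) ->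
    \dim {:A} = 3%N -> \dim H = 2%N ->
    (forall x y, x ** y \in H) -> (forall x y, x ** y \in (psi @: H)%VS) ->
    {in H &, injective psi} -> {in H &, forall x y, psi (x ** y) = psi x ** psi y} ->
    (exists x y, [/\ x \in H, y \in H & x ** y <> 0]) ->
    (psi @: H)%VS <> H ->
  exists g : 'End(A), alg_iso g /\ (g @: H)%VS = (psi @: H)%VS.
Proof.
move=> perf mC d3 d2 inH inJ psi_inj psiM [x0 [y0 [x0H y0H /eqP xy0]]].
set J := (psi @: H)%VS => JH.
have dJ : \dim J = 2%N.
  rewrite -d2; apply: limg_dim_eq; apply/eqP; rewrite -subv0.
  apply/subvP => v; rewrite memv_cap memv_ker memv0 => /andP[vH /eqP pv].
  by apply/eqP/psi_inj; rewrite ?mem0v // pv linear0.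
have HJ : ~~ (H <= J)%VS 
  by apply/negP => HJ; case: JH; apply/esym/eqP; rewrite eqEdim HJ dJ d2.
have [m1 m1H m1J] := subvPn HJ.
pose l := x0 ** y0.
have lH : l \in H by apply: inH.
have lJ : l \in J by apply: inJ.
have l0 : l != 0 := xy0.
have HJl : (H :&: J)%VS = <[l]>%VS.
  apply/esym/eqP; rewrite eqEdim -memvE memv_cap lH lJ dim_vline l0 /=.
  have capH : (H :&: J <= H)%VS := capvSl _ _.
  have : (\dim (H :&: J) <= 2)%N by rewrite -d2 dimvS.
  rewrite leq_eqVlt ltnS => /orP[/eqP d|//].
  have : (H :&: J == H)%VS by rewrite eqEdim capH d d2.
  by move/eqP/capv_idPl; rewrite (negPf HJ).
have prod_l x y : exists q, x ** y = q *: l.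
  by apply/vlineP; rewrite -HJl memv_cap inH inJ.
have [c psil] : exists c, psi l = c *: l by rewrite psiM; first exact: prod_l.
have c0 : c != 0.
  apply: contraNneq l0 => c0; rewrite c0 scale0r in psil.
  by apply/eqP/psi_inj; rewrite ?mem0v // psil linear0.
pose m2 := psi m1.
have m1l : m1 \notin <[l]>%VS by rewrite -HJl memv_cap (negPf m1J) andbF.
have H_lm : (<[l]> + <[m1]>)%VS = H.
  apply/eqP; rewrite eqEdim d2 subv_add -!memvE lH m1H /=.
  have : free [:: m1; l] by rewrite free_cons span_seq1 m1l seq1_free l0.
  by rewrite /free span_cons span_seq1 addvC => /eqP->.
have m2J : psi m1 \in J by apply: memv_img.
have m2lm : m2 \notin (<[l]> + <[m1]>)%VS.
  rewrite H_lm; apply/negP => m2H; case/negP: m1l.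
  have /vlineP[a m2E] : m2 \in <[l]>%VS by rewrite -HJl memv_cap m2H.
  apply/vlineP; exists (a * c^-1); apply: psi_inj; rewrite ?memvZ //.
  by rewrite -/m2 m2E linearZ /= psil scalerA mulfVK.
have scale_l a b : a *: l = b *: l -> a = b.
  by move/eqP; rewrite -subr_eq0 -scalerBl scaler_eq0 (negPf l0) orbF subr_eq0 => /eqP.
have [n ll] := prod_l l l; have [p lm1] := prod_l l m1.
have [s m11] := prod_l m1 m1; have [t m12] := prod_l m1 m2.
have nc : n = c * n.
  have := psiM l l lH lH; rewrite ll linearZ /= !psil !amulE ll !scalerA => /scale_l E.
  by apply: (mulfI c0); rewrite mulrA -E mulrC.
have lm2 : l ** m2 = p *: l.
  have := psiM l m1 lH m1H; rewrite lm1 linearZ /= !psil -/m2 !amulE.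
  by move=> E; apply: (scalerI c0); rewrite -E !scalerA mulrC.
have m22 : m2 ** m2 = (c * s) *: l.
  by rewrite -psiM // m11 linearZ /= psil scalerA mulrC.
have [d [x [y [z [w [d0 x_0 [E1 E2 E3] [E4 E5 E6]]]]]]] :=
  similitude_solution p s t perf c0 nc.
(* The images of m1 and m2 under the automorphism, l being sent to d l. *)
pose b1 := m2 + z *: l; pose b2 := x *: m1 + y *: m2 + w *: l.
have lineZ a : a *: l \in <[l]>%VS by apply/vlineP; exists a.
have basisX := basis3 d3 l0 m1l m2lm.
have dl0 : d *: l != 0 by rewrite scaler_eq0 negb_or d0.
have b1J : b1 \in J by rewrite memvD ?memvZ.
have dlE : <[d *: l]>%VS = <[l]>%VS.
  apply/eqP; rewrite eqEdim !dim_vline l0 dl0 leqnn andbT.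
  by rewrite -memvE lineZ.
have basisY : basis_of fullv [:: d *: l; b1; b2].
  apply: basis3 => //; rewrite dlE.
    rewrite rpredDr ?lineZ //; apply: contra m2lm; exact: (subvP (addvSl _ _)).
  apply: contra m1J => b2lb1; have b2J : b2 \in J.
    by apply: subvP b2lb1; rewrite subv_add -!memvE lJ.
  have ywJ : y *: m2 + w *: l \in J by rewrite memvD ?memvZ.
  move: b2J; rewrite /b2 -addrA (rpredDr _ ywJ) => xm1J.
  by rewrite -[m1]scale1r -(mulVf x_0) -scalerA memvZ.
have m1l' := etrans (mC m1 l) lm1; have m2l' := etrans (mC m2 l) lm2.
have m21 := etrans (mC m2 m1) m12.
have table := (ll, lm1, lm2, m1l', m2l', m11, m12, m21, m22).
have [|g [gI gE]] :=
  @basis_map_iso [tuple l; m1; m2] [tuple d *: l; b1; b2] basisX basisY mC.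
  move=> g gE; have gl : g l = d *: l := gE ord0.
  have prodE u v q e : u ** v = q *: l -> q * d = e -> g (u ** v) = e *: l.
    by move=> -> <-; rewrite linearZ /= gl scalerA.
  case=> [[|[|[|//]]] ?] [[|[|[|//]]] ?] //= _.
  - by rewrite (prodE _ _ _ _ ll E1) !amulE !table !scalerA.
  - rewrite (prodE _ _ _ _ lm1 E2) !amulE !table ?scalerDr !scalerA -!scalerDl.
    by congr (_ *: _); ring.
  - rewrite (prodE _ _ _ _ lm2 E3) !amulE !table ?scalerDr !scalerA -!scalerDl.
    by congr (_ *: _); ring.
  - rewrite (prodE _ _ _ _ m11 E4) !amulE !table ?scalerDr !scalerA -!scalerDl.
    by congr (_ *: _); ring.
  - rewrite (prodE _ _ _ _ m12 E5) !amulE !table ?scalerDr !scalerA -!scalerDl.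
    by congr (_ *: _); ring.
  - rewrite (prodE _ _ _ _ m22 E6) !amulE !table ?scalerDr !scalerA -!scalerDl.
    by congr (_ *: _); ring.
have gl : g l = d *: l := gE ord0.
have gm1 : g m1 = b1 := gE (Ordinal (isT : 1 < 3)%N).
exists g; split=> //; apply/eqP; rewrite eqEdim dJ -d2 limg_dim_eq; last first.
  have [[g' gK _] _] := gI.
  by have /eqP -> : lker g == 0%VS; [apply/lker0P/(can_inj gK) | rewrite capv0].
by rewrite leqnn andbT -H_lm limgD !limg_line gl gm1 subv_add -!memvE memvZ.
Qed.

End Hyperplanes.

(** * Isomorphisms that move the base *)

Lemma memv_img_inj (K : fieldType) (U V : vectType K) (g : 'Hom(U, V))
    (W : {vspace U}) p :
  injective g -> (g p \in (g @: W)%VS) = (p \in W).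
Proof.
move=> g_inj; apply/idP/idP => [/memv_imgP[q qW /g_inj-> //]|].
exact: memv_img.
Qed.

(** If f does not send H to H', then f^-1 after tau is an isomorphism of H onto the
    other hyperplane f^-1(H'), and f is corrected by an automorphism that carries
    the first hyperplane onto the second. *)
Lemma straighten_iso (K : fieldType) (A A' : algebra K)
    (H : {vspace A}) (H' : {vspace A'}) (f tau : 'Hom(A, A')) :
    not_imperfect_char2 K -> (forall p q : A, p ** q = q ** p) ->
    \dim {:A} = 3%N -> \dim H = 2%N ->
    (forall p q : A, p ** q \in H) -> (forall p q : A', p ** q \in H') ->
    (exists p q, [/\ p \in H, q \in H & p ** q <> 0]) ->
    {in H &, injective tau} -> {in H &, {morph tau : p q / p ** q}} ->
    (tau @: H)%VS = H' -> alg_iso f ->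
  exists g : 'Hom(A, A'), alg_iso g /\ forall p, (g p \in H') = (p \in H).
Proof.
move=> perf mC dA dH prodH prodH' nz tau_inj tauM tauH fI.
have [g0 [_ g0M] [fK g0K]] := alg_iso_inv fI.
pose psi : 'End(A) := (g0 \o tau)%VF.
have psiE p : psi p = g0 (tau p) by rewrite comp_lfunE.
have fpsi : (f @: (psi @: H))%VS = H'.
  rewrite -tauH limg_comp -limg_comp; apply/vspaceP => v; apply/memv_imgP/idP.
    by move=> [_ /memv_imgP[h hH ->] ->]; rewrite comp_lfunE g0K memv_img.
  move=> /memv_imgP[h hH ->]; exists (tau h); first exact: memv_img.
  by rewrite comp_lfunE g0K.
have [psiH | /eqP psiH] := eqVneq (psi @: H)%VS H.
  by exists f; split=> // p; rewrite -fpsi psiH memv_img_inj //; apply: can_inj fK.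
have prod_psi p q : p ** q \in (psi @: H)%VS.
  have := prodH' (f p) (f q); rewrite -fI.2 -tauH => /memv_imgP[h hH E].
  by rewrite -[_ ** _]fK E -psiE memv_img.
have psi_inj : {in H &, injective psi}.
  by move=> p q pH qH; rewrite !psiE => /(can_inj g0K); apply: tau_inj.
have psiM : {in H &, forall p q, psi (p ** q) = psi p ** psi q}.
  by move=> p q pH qH; rewrite !psiE tauM.
have [g [gI gH]] :=
  swap_hyperplanes perf mC dA dH prodH prod_psi psi_inj psiM nz psiH.
exists (f \o g)%VF; split; first exact: alg_iso_comp.
move=> p; rewrite comp_lfunE -fpsi -gH.
rewrite memv_img_inj; last exact: can_inj fK.
by rewrite memv_img_inj //; apply: bij_inj gI.1.
Qed.

Section IsomorphismsOfAdjunctions.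
Variables (K : fieldType) (B : algebra K).
Hypothesis mC : forall a b : B, a ** b = b ** a.
Implicit Types x y : 'End(B) * B.

Lemma adj2_commutative x (p q : Adj2_0 x) : p ** q = q ** p.
Proof.
rewrite !adj2E; congr (_, _); rewrite [p.1 ** _]mC [p.2 * _]mulrC.
by congr (_ + _); rewrite addrAC.
Qed.

Lemma adj2_base x : exists2 H : {vspace Adj2_0 x},
  forall p, (p \in H) = (p.2 == 0) & \dim H = \dim {:B}.
Proof.
have iotaL : linear (fun b : B => (b, 0) : Adj2_0 x).
  by move=> a s t; congr (_, _); rewrite /= [a *: 0]scaler0 addr0.
have [iota iotaE] := linear_lfun iotaL.
exists (limg iota).
  move=> [b r]; apply/memv_imgP/eqP => /= [[c _]|->]; first by rewrite iotaE => -[].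
  by exists b; rewrite ?memvf ?iotaE.
apply: limg_dim_eq; apply/eqP; rewrite capfv; apply/lker0P.
by move=> s t; rewrite !iotaE => -[].
Qed.

Lemma iso_same_orbit x y (f : 'Hom(Adj2_0 x, Adj2_0 y)) :
    not_imperfect_char2 K -> \dim {:B} = 2%N ->
    (exists u v : B, u ** v <> 0) -> alg_iso f ->
  same_orbit x y.
Proof.
move=> perf dB [u [v uv0]] fI.
have [H memH dH] := adj2_base x; have [H' memH' _] := adj2_base y.
have tauL : linear (fun p : Adj2_0 x => (p.1, 0) : Adj2_0 y).
  by move=> a s t; congr (_, _); rewrite /= [a *: 0]scaler0 addr0.
have [tau tauE] := linear_lfun tauL.
have dA : \dim {:Adj2_0 x} = 3%N.
  by rewrite dimvf /= [dim _]/(dim B + 1)%N -dimvf dB.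
have prodH p q : p ** q \in H by rewrite memH adj2E.
have prodH' p q : p ** q \in H' by rewrite memH' adj2E.
have nz : exists p q, [/\ p \in H, q \in H & p ** q <> 0].
  exists (u, 0), (v, 0); rewrite !memH /= eqxx; split=> //.
  by rewrite adj2E /= mul0r !scale0r !addr0 => -[].
have tau_inj : {in H &, injective tau}.
  move=> [p r] [q s]; rewrite !memH !tauE /= => /eqP-> /eqP->.
  by move=> /(congr1 fst)/= ->.
have tauM : {in H &, {morph tau : p q / p ** q}}.
  move=> p q; rewrite !memH => /eqP p2 /eqP q2.
  have Ex : (p ** q).1 = p.1 ** q.1.
    by rewrite adj2E /= p2 q2 mul0r !scale0r !addr0.
  have Ey : ((p.1, 0) : Adj2_0 y) ** (q.1, 0) = (p.1 ** q.1, 0).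
    by rewrite adj2E /= mul0r !scale0r !addr0.
  by rewrite (tauE (p ** q)) Ex (tauE p) (tauE q) Ey.
have tauH : (tau @: H)%VS = H'.
  apply/vspaceP => p; rewrite memH'; apply/memv_imgP/eqP => [[q _ ->]|p2].
    by rewrite tauE.
  exists (p.1, 0); first by rewrite memH.
  by rewrite tauE /= -p2 -surjective_pairing.
have [g [gI gH]] :=
  straighten_iso perf (@adj2_commutative x) dA (etrans dH dB) prodH prodH' nz
    tau_inj tauM tauH fI.
apply: (iso_orbit mC gI) => p.
have E : ((g p).2 == 0) = (p.2 == 0) :=
  etrans (etrans (esym (memH' (g p))) (gH p)) (memH p).
by split=> /eqP p2; apply/eqP; [rewrite -E | rewrite E].
Qed.

End IsomorphismsOfAdjunctions.

(** * Ideals of codimension one *)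

Lemma dim_subalg (K : fieldType) (A : algebra K) (S : {vspace A}) :
  \dim {:subalg S} = \dim S.
Proof. by rewrite dimvf. Qed.

Section CodimensionOne.
Variables (K : fieldType) (A : algebra K) (S : {vspace A}) (w : A).
Hypotheses (mC : forall x y : A, x ** y = y ** x).
Hypotheses (prodS : forall x y : A, x ** y \in S).
Hypotheses (wS : w \notin S) (dimA : \dim {:A} = (\dim S).+1).

Lemma codim1_split a : exists (s : subvs_of S) r, a = vsval s + r *: w.
Proof.
have w0 : w != 0 by apply: contraNneq wS => ->; rewrite mem0v.
have Sw : (S + <[w]>)%VS = fullv.
  apply/eqP; rewrite eqEdim subvf dimA /= ltnNge; apply/negP => le.
  case/negP: wS; have /eqP -> : S == (S + <[w]>)%VS by rewrite eqEdim addvSl.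
  by rewrite memvE addvSr.
have /memv_addP[s sS [_ /vlineP[r ->] ->]] : a \in (S + <[w]>)%VS by rewrite Sw memvf.
by exists (Subvs sS), r.
Qed.

Lemma subalg_mulE (b c : subalg S) : vsval (b ** c) = vsval b ** vsval c.
Proof. exact: vsprojK. Qed.

(** Every element is s + r w with s in S, so the product is determined by the one
    of S, by multiplication by w, and by w w; the coefficient of w in a product is
    always 0. *)
Lemma codim1_adj2 : exists (phi : 'End(subalg S)) (b0 : subalg S),
  (forall c, vsval (phi c) = w ** vsval c) /\
  exists f : 'Hom(A, Adj2 phi b0 0),
    alg_iso f /\ forall b : subalg S, f (vsval b) = (b, 0).
Proof.
have phiL : linear (fun c : subalg S => vsproj S (w ** vsval c) : subalg S).
  by by move=> a s t; rewrite [vsval _]linearP /= amulDr amulZr linearP.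
have [phi phiE] := linear_lfun phiL.
have phiV c : vsval (phi c) = w ** vsval c by rewrite phiE vsprojK.
pose b0 : subalg S := vsproj S (w ** w).
have b0V : vsval b0 = w ** w by rewrite vsprojK.
exists phi, b0; split=> //.
have gL : linear (fun p : Adj2 phi b0 0 => vsval p.1 + p.2 *: w).
  move=> a [s r] [t q]; rewrite /= scalerDl scalerDr scalerA.
  by rewrite addrACA.
have [g gE] := linear_lfun gL.
have gI : alg_iso g.
  split.
    have g_inj : injective g.
      move=> [s a] [t b]; rewrite !gE /= => E.
      have ab : a = b.
        apply/eqP; rewrite -subr_eq0; apply: contraR wS => ab0.
        rewrite -[w]scale1r -(mulVf ab0) -scalerA memvZ // scalerBl.
        have -> : a *: w - b *: w = vsval t - vsval s.
          by apply/eqP; rewrite subr_eq addrAC eq_sym subr_eq -E addrC.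
        by rewrite memvB ?subvsP.
      by move: E; rewrite ab => /addIr /subvs_inj ->.
    have g_surj a : a \in limg g.
      have [s [r ->]] := codim1_split a.
      have -> : vsval s + r *: w = g (s, r) by rewrite gE.
      exact: memv_img (memvf _).
    exists (g^-1)%VF => [p|a]; first by rewrite lker0_lfunK //; apply/lker0P.
    by rewrite limg_lfunVK.
  move=> [s a] [t b]; rewrite adj2E !gE /= scale0r addr0 !linearD !linearZ /=.
  rewrite !phiV b0V subalg_mulE !amulE [vsval s ** w]mC !scalerDr !scalerA.
  by rewrite [b * a]mulrC addrA; congr (_ + _); rewrite addrAC.
have [f fI [gK fK]] := alg_iso_inv gI.
exists f; split=> // b; have := gK (b, 0).
by rewrite gE /= scale0r addr0.
Qed.

(** For an ideal of the subalgebra S, invariance under multiplication by w is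
    exactly what makes it an ideal of A. *)
Lemma minimal_no_invariant_ideal (phi : 'End(subalg S)) :
    (forall c, vsval (phi c) = w ** vsval c) -> minimal_ideal S ->
  no_invariant_ideal phi.
Proof.
move=> phiV [_ _ minS] J idJ phiJ.
have vL : linear (fun b : subalg S => vsval b) by move=> a s t; rewrite linearP.
have [v vE] := linear_lfun vL.
have v_inj : injective v by move=> s t; rewrite !vE => /subvs_inj.
have memI s : s \in J -> vsval s \in (v @: J)%VS.
  by move=> sJ; rewrite -[vsval s]vE memv_img.
have idI : ideal (v @: J)%VS.
  suff lI a x : x \in (v @: J)%VS -> a ** x \in (v @: J)%VS.
    by move=> a x xI; rewrite [x ** a]mC; split; apply: lI.
  have [s [r ->]] := codim1_split a.
  move=> /memv_imgP[j jJ ->]; rewrite vE !amulE -phiV -subalg_mulE.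
  rewrite memvD ?memvZ ?memI //; first by case: (idJ s j jJ).
  by apply: (subvP phiJ); apply: memv_img.
have IS : (v @: J <= S)%VS.
  by apply/subvP => _ /memv_imgP[j _ ->]; rewrite vE subvsP.
have kv : (J :&: lker v)%VS = 0%VS by have /eqP -> := introT lker0P v_inj; rewrite capv0.
have [I0|IE] := minS _ idI IS.
  by left; apply/eqP; rewrite -dimv_eq0 -(limg_dim_eq kv) I0 dimv0.
right; apply/eqP; rewrite eqEdim subvf -(limg_dim_eq kv) IE dimvf.
exact: leqnn.
Qed.

End CodimensionOne.

(** * The socle of a non-degenerate three-dimensional evolution algebra *)

Section Socle.
Variables (K : fieldType) (A : algebra K).
Implicit Types (S I J : {vspace A}).

Lemma ideal_sum (s : seq {vspace A}) :
  (forall I, I \in s -> ideal I) -> ideal (\sum_(I <- s) I)%VS.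
Proof.
elim: s => [_ a x|I s IH idI a x]; first by
  rewrite big_nil memv0 => /eqP->; rewrite !amulE mem0v.
rewrite big_cons => /memv_addP[y yI [z zs ->]].
have [ay ya] := idI I (mem_head _ _) a y yI.
have [|az za] := IH _ a z zs; first by move=> J Js; apply: idI; rewrite in_cons Js orbT.
by rewrite !amulE !memv_add.
Qed.

Lemma Soc_ideal S : is_Soc S -> ideal S.
Proof.
move=> SocS a x /SocS[s sP xs].
have idS : ideal (\sum_(I <- s) I)%VS by apply: ideal_sum => I /sP[[]].
by have [ax xa] := idS a x xs; split; apply/SocS; exists s.
Qed.

(** A subspace that misses part of the socle misses one of its summands. *)
Lemma Soc_component S J : is_Soc S -> ~~ (S <= J)%VS ->
  exists I, [/\ minimal_ideal I, exists a x : A, x \in I /\ a ** x <> 0,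
                (I <= S)%VS & ~~ (I <= J)%VS].
Proof.
move=> SocS /subvPn[v /SocS[s sP vs] vJ].
have /allPn[I Is IJ] : ~~ all (fun I => I <= J)%VS s.
  apply: contra vJ => /allP sJ; apply: subvP vs.
  by rewrite big_seq; elim/big_ind: _ => [|U V UJ VJ|I /sJ //]; rewrite ?sub0v // subv_add UJ.
have [minI nzI] := sP I Is.
exists I; split=> //; apply/subvP => x xI; apply/SocS; exists [:: I].
  by move=> J'; rewrite inE => /eqP->.
by rewrite big_seq1.
Qed.

Variables e1 e2 e3 : A.
Let u := e2 + e3.
Let S := <<[:: e1; u]>>%VS.
Hypothesis nb : natural_basis fullv [:: e1; e2; e3].

Let mC : forall x y : A, x ** y = y ** x := natural_basis_commutative nb.

Lemma evolution3_orth : [/\ e1 ** e2 = 0, e1 ** e3 = 0 & e2 ** e3 = 0].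
Proof.
have [_ orth] := nb.
by split; [apply: (orth 0 1) | apply: (orth 0 2) | apply: (orth 1 2)].
Qed.

Lemma evolution3_split v : exists a b c, v = a *: e1 + b *: e2 + c *: e3.
Proof.
have [/span_basis spanE _] := nb; have := memvf v; rewrite -spanE !span_cons span_nil addv0.
move=> /memv_addP[_ /vlineP[a ->] [_ /memv_addP[_ /vlineP[b ->] [_ /vlineP[c ->] ->]] ->]].
by exists a, b, c; rewrite addrA.
Qed.

Lemma evolution3_free a b c :
  a *: e1 + b *: e2 + c *: e3 = 0 -> [/\ a = 0, b = 0 & c = 0].
Proof.
have [/basis_free freeE _] := nb => E.
have /freeP free3 : free [tuple e1; e2; e3] by [].
have := free3 (fun i => [tuple a; b; c]`_i).
rewrite !big_ord_recl big_ord0 /= addr0 addrA => /(_ E) H.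
by split; [apply: (H ord0) | apply: (H (Ordinal (isT : 1 < 3)%N))
             | apply: (H (Ordinal (isT : 2 < 3)%N))].
Qed.

Lemma evolution3_ideal I :
    (forall x, x \in I -> [/\ e1 ** x \in I, e2 ** x \in I & e3 ** x \in I]) ->
  ideal I.
Proof.
move=> eI; suff lI a x : x \in I -> a ** x \in I.
  by move=> a x xI; rewrite [x ** a]mC; split; apply: lI.
move=> /eI[x1 x2 x3]; have [a1 [a2 [a3 ->]]] := evolution3_split a.
by rewrite !amulE !memvD ?memvZ.
Qed.

Lemma plane_split v : v \in S -> exists a b, v = a *: e1 + b *: u.
Proof.
rewrite /S !span_cons span_nil addv0.
by move=> /memv_addP[_ /vlineP[a ->] [_ /vlineP[b ->] ->]]; exists a, b.
Qed.

Lemma mem_plane : e1 \in S /\ u \in S.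
Proof. by split; apply: memv_span; rewrite !inE eqxx ?orbT. Qed.

Lemma mul_plane a b :
  [/\ e1 ** (a *: e1 + b *: u) = a *: (e1 ** e1),
      e2 ** (a *: e1 + b *: u) = b *: (e2 ** e2) &
      e3 ** (a *: e1 + b *: u) = b *: (e3 ** e3)].
Proof.
have [o12 o13 o23] := evolution3_orth.
rewrite !amulE [e2 ** e1]mC [e3 ** e1]mC [e3 ** e2]mC o12 o13 o23.
by rewrite !scaler0 !(addr0, add0r, scaler0).
Qed.

Lemma plane_free a b : a *: e1 + b *: u = 0 -> a = 0 /\ b = 0.
Proof. by rewrite scalerDr addrA => /evolution3_free[]. Qed.

Lemma evolution3_dim : \dim {:A} = 3%N.
Proof. by have [/size_basis/= ->] := nb. Qed.

Lemma e2_notin_plane : e2 \notin S.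
Proof.
apply/negP => /plane_split[a [b E]].
have /evolution3_free[_ /eqP b1 b0] : a *: e1 + (b - 1) *: e2 + b *: e3 = 0.
  apply/eqP; rewrite scalerBl scale1r addrA [X in X == _]addrAC subr_eq0.
  by rewrite -addrA -scalerDr -E.
by rewrite b0 sub0r oppr_eq0 oner_eq0 in b1.
Qed.

Lemma natural_basis_plane : natural_basis S [:: e1; u].
Proof.
have [o12 o13 _] := evolution3_orth; split.
  rewrite /basis_of eqxx /=; apply/(@freeP _ _ _ [tuple e1; u]) => k.
  rewrite !big_ord_recl big_ord0 /= addr0 => /plane_free[k0 k1].
  by case=> [[|[|//]] ?]; [rewrite -[RHS]k0 | rewrite -[RHS]k1]; congr k; apply: val_inj.
by case=> [|[|//]] [|[|//]] //= _ _ _; rewrite ?[u ** e1]mC amulDr o12 o13 addr0.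
Qed.

Lemma dim_plane : \dim S = 2%N.
Proof. by have [/size_basis/= ->] := natural_basis_plane. Qed.

Hypothesis nd : non_degenerate A.

(** If e_i e_i = 0 then e_i annihilates the whole basis. *)
Lemma square_neq0 : [/\ e1 ** e1 != 0, e2 ** e2 != 0 & e3 ** e3 != 0].
Proof.
have [o12 o13 o23] := evolution3_orth.
have annih x : e1 ** x = 0 -> e2 ** x = 0 -> e3 ** x = 0 -> x = 0.
  move=> x1 x2 x3; apply: nd => a; rewrite [x ** a]mC.
  have [a1 [a2 [a3 ->]]] := evolution3_split a.
  by rewrite !amulE x1 x2 x3 !scaler0 !addr0.
split; apply/eqP => sq.
- have e0 : e1 = 0 by apply: annih; rewrite // mC.
  by have [|/eqP] := evolution3_free (a := 1) (b := 0) (c := 0);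
    rewrite ?oner_eq0 // e0 !scale0r scaler0 !addr0.
- have e0 : e2 = 0 by apply: annih; rewrite // mC.
  by have [|_ /eqP] := evolution3_free (a := 0) (b := 1) (c := 0);
    rewrite ?oner_eq0 // e0 !scale0r scaler0 !addr0.
- have e0 : e3 = 0 by apply: annih; rewrite // mC.
  by have [|_ _ /eqP] := evolution3_free (a := 0) (b := 0) (c := 1);
    rewrite ?oner_eq0 // e0 !scale0r scaler0 !addr0.
Qed.

Lemma e1_neq0 : e1 != 0.
Proof. by have [+ _ _] := square_neq0; apply: contraNneq => ->; rewrite amulE. Qed.

Hypothesis SocS : is_Soc S.

(** e2 u = e2 e2 and e3 u = e3 e3, because e2 e3 = 0. *)
Lemma square_in_socle : [/\ e1 ** e1 \in S, e2 ** e2 \in S & e3 ** e3 \in S].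
Proof.
have [e1S uS] := mem_plane; have idS := Soc_ideal SocS.
have [_ m2 m3] := mul_plane 0 1.
move: m2 m3; rewrite scale0r !scale1r add0r => m2 m3.
split; last by rewrite -m3; case: (idS e3 u uS).
  by case: (idS e1 e1 e1S).
by rewrite -m2; case: (idS e2 u uS).
Qed.

Lemma mul_in_socle x y : x ** y \in S.
Proof.
have [s1 s2 s3] := square_in_socle; have [o12 o13 o23] := evolution3_orth.
have [a1 [a2 [a3 ->]]] := evolution3_split x.
have [b1 [b2 [b3 ->]]] := evolution3_split y.
rewrite !amulE [e2 ** e1]mC [e3 ** e1]mC [e3 ** e2]mC o12 o13 o23.
by rewrite !scaler0 !(addr0, add0r) !memvD ?memvZ.
Qed.

Hypothesis ind : indecomposable A.

(** Otherwise A would be the direct sum of the ideals <e1> and <e2, e3>. *)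
Lemma not_split_squares : e1 ** e1 \in <[e1]>%VS -> e2 ** e2 \in <[u]>%VS ->
  e3 ** e3 \in <[u]>%VS -> False.
Proof.
move=> s1 s2 s3; have [o12 o13 o23] := evolution3_orth.
have uJ : (<[u]> <= <[e2]> + <[e3]>)%VS by rewrite -memvE memv_add ?memv_line.
apply: ind; exists <[e1]>%VS, (<[e2]> + <[e3]>)%VS.
split.
- apply: evolution3_ideal => _ /vlineP[a ->].
  by rewrite !amulE [e2 ** e1]mC [e3 ** e1]mC o12 o13 scaler0 mem0v memvZ.
- apply: evolution3_ideal => _ /memv_addP[_ /vlineP[a ->] [_ /vlineP[b ->] ->]].
  rewrite !amulE [e3 ** e2]mC o12 o13 o23 !scaler0 !(add0r, addr0) mem0v.
  by split=> //; rewrite memvZ // (subvP uJ).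
- by apply/eqP; rewrite -dimv_eq0 dim_vline e1_neq0.
- move/eqP; rewrite -subv0 subv_add => /andP[+ _]; rewrite -memvE memv0 => /eqP e20.
  by have [_ + _] := square_neq0; rewrite e20 amulE eqxx.
- split.
    apply/eqP; rewrite eqEsubv subvf; apply/subvP => v _.
    have [a [b [c ->]]] := evolution3_split v.
    by rewrite -addrA !memv_add // memvZ ?memv_line.
  apply/eqP; rewrite -subv0; apply/subvP => _ /memv_capP[/vlineP[a ->]].
  move=> /memv_addP[_ /vlineP[b ->] [_ /vlineP[c ->] E]].
  have [|-> _ _] := @evolution3_free a (- b) (- c).
    by rewrite E !scaleNr -[LHS]addrA -opprD subrr.
  by rewrite scale0r mem0v.
Qed.

(** If both coordinates of z are nonzero, e1 z and e2 z put e1 e1 and e2 e2 in I;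
    then e1 x and e2 x, multiples of these squares, lie in both ideals and vanish,
    which forces x = 0. *)
Lemma disjoint_ideals_split I J x z : ideal I -> ideal J ->
    (I <= S)%VS -> (J <= S)%VS -> (I :&: J = 0)%VS ->
    z \in I -> z <> 0 -> x \in J -> x <> 0 ->
  e1 \in I \/ u \in I.
Proof.
move=> idI idJ IS JS capIJ zI z0 xJ x0.
have [sq1 sq2 sq3] := square_neq0.
have [a [b zE]] := plane_split (subvP IS _ zI).
have [c [d xE]] := plane_split (subvP JS _ xJ).
have cancelI r v : r != 0 -> r *: v \in I -> v \in I.
  by move=> r0 rv; rewrite -[v]scale1r -(mulVf r0) -scalerA memvZ.
have [a0 | a0] := eqVneq a 0.
  right; apply: (@cancelI b); last by rewrite -[_ *: _]add0r -(scale0r e1) -a0 -zE.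
  by apply/eqP => b0; apply: z0; rewrite zE a0 b0 !scale0r addr0.
have [b0 | b0] := eqVneq b 0.
  by left; apply: (@cancelI a) => //; rewrite -[_ *: _]addr0 -(scale0r u) -b0 -zE.
have [z1 z2 _] := mul_plane a b; have [x1 x2 _] := mul_plane c d.
have e1I : e1 ** e1 \in I.
  by apply: (@cancelI a) => //; rewrite -z1 -zE; case: (idI e1 z zI).
have e2I : e2 ** e2 \in I.
  by apply: (@cancelI b) => //; rewrite -z2 -zE; case: (idI e2 z zI).
have zero r v : v != 0 -> r *: v \in I -> r *: v \in J -> r = 0.
  move=> v0 vI vJ; have : r *: v \in (I :&: J)%VS by rewrite memv_cap vI.
  by rewrite capIJ memv0 scaler_eq0 (negPf v0) orbF => /eqP.
have c0 : c = 0.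
  apply: (zero c _ sq1); first by rewrite memvZ.
  by rewrite -x1 -xE; case: (idJ e1 x xJ).
have d0 : d = 0.
  apply: (zero d _ sq2); first by rewrite memvZ.
  by rewrite -x2 -xE; case: (idJ e2 x xJ).
by case: x0; rewrite xE c0 d0 !scale0r addr0.
Qed.

(** Disjointness reduces I and J to the lines of e1 and u. *)
Lemma disjoint_ideals_false I J : ideal I -> ideal J ->
    (I <= S)%VS -> (J <= S)%VS -> (I :&: J = 0)%VS ->
  e1 \in I -> u \in J -> False.
Proof.
move=> idI idJ IS JS capIJ e1I uJ.
have capE v : v \in I -> v \in J -> v = 0.
  by move=> vI vJ; apply/eqP; rewrite -memv0 -capIJ memv_cap vI.
have I1 v : v \in I -> v \in <[e1]>%VS.
  move=> vI; have [a [b vE]] := plane_split (subvP IS _ vI).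
  have bu : b *: u = 0.
    apply: capE; last by rewrite memvZ.
    have -> : b *: u = v - a *: e1 by rewrite vE addrC addKr.
    by rewrite memvB ?memvZ.
  by rewrite vE bu addr0 memvZ ?memv_line.
have J1 v : v \in J -> v \in <[u]>%VS.
  move=> vJ; have [a [b vE]] := plane_split (subvP JS _ vJ).
  have ae : a *: e1 = 0.
    apply: capE; first by rewrite memvZ.
    have -> : a *: e1 = v - b *: u by rewrite vE addrK.
    by rewrite memvB ?memvZ.
  by rewrite vE ae add0r memvZ ?memv_line.
have [_ m2 m3] := mul_plane 0 1; rewrite scale0r !scale1r add0r in m2 m3.
apply: not_split_squares; first by apply: I1; case: (idI e1 e1 e1I).
  by apply: J1; rewrite -m2; case: (idJ e2 u uJ).
by apply: J1; rewrite -m3; case: (idJ e3 u uJ).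
Qed.

Lemma socle_minimal : minimal_ideal S.
Proof.
have [sq1 sq2 sq3] := square_neq0; have [e1S uS] := mem_plane.
split; first exact: Soc_ideal.
  by apply/eqP; rewrite -dimv_eq0 dim_plane.
move=> J idJ JS; have [-> | J0] := eqVneq J 0%VS; first by left.
right; apply/eqP; rewrite eqEsubv JS; apply/negP => SJ.
have [I [[idI I0 minI] _ IS IJ]] := Soc_component SocS (introN idP SJ).
(* Minimality of I: its intersection with J is an ideal other than I. *)
have /eqP capIJ : (I :&: J)%VS == 0%VS.
  have idIJ : ideal (I :&: J)%VS.
    move=> a x /memv_capP[xI xJ]; have [xI1 xI2] := idI a x xI.
    by have [xJ1 xJ2] := idJ a x xJ; rewrite !memv_cap xI1 xI2 xJ1.
  have [-> // | IJE] := minI _ idIJ (capvSl _ _).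
  by case/negP: IJ; apply/capv_idPl.
have capJI : (J :&: I = 0)%VS by rewrite capvC.
have nz (U : {vspace A}) : U <> 0%VS -> exists2 x, x \in U & x <> 0.
  move=> U0; exists (vpick U); first exact: memv_pick.
  by apply/eqP; rewrite vpick0; apply/eqP.
have [xI xII xI0] := nz I I0; have [xJ xJJ xJ0] := nz J (elimN eqP J0).
have [e1I | uI] := disjoint_ideals_split idI idJ IS JS capIJ xII xI0 xJJ xJ0;
have [e1J | uJ] := disjoint_ideals_split idJ idI JS IS capJI xJJ xJ0 xII xI0.
- have : e1 \in (I :&: J)%VS by rewrite memv_cap e1I.
  by rewrite capIJ memv0 => /eqP e10; rewrite e10 amulE eqxx in sq1.
- exact: (disjoint_ideals_false idI idJ IS JS capIJ e1I uJ).
- exact: (disjoint_ideals_false idJ idI JS IS capJI e1J uI).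
- have : u \in (I :&: J)%VS by rewrite memv_cap uI.
  have [_ m2 _] := mul_plane 0 1; rewrite scale0r !scale1r add0r in m2.
  by rewrite capIJ memv0 => /eqP u0; rewrite -m2 u0 amulE eqxx in sq2.
Qed.

Hypothesis no_ext : ~ extension_property S.

(** If phi is the left multiplication by b then e2 - b annihilates S, so it extends
    the natural basis {e1, u} of S to one of A. *)
Lemma socle_not_left_mul (phi : 'End(subalg S)) :
  (forall c, vsval (phi c) = e2 ** vsval c) -> not_left_mul phi.
Proof.
move=> phiV [b phib]; apply: no_ext.
have [o12 o13 o23] := evolution3_orth; have [e1S uS] := mem_plane.
have actE v : v \in S -> e2 ** v = vsval b ** v.
  move=> vS; have := phiV (Subvs vS); rewrite phib lmulE /= => <-.
  by rewrite subalg_mulE //; exact: mul_in_socle.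
exists [:: e1; u], [:: e2 - vsval b]; split; first exact: natural_basis_plane.
have wS v : v \in S -> (e2 - vsval b) ** v = 0.
  by move=> vS; rewrite amulBl actE ?subrr.
split.
  apply: basis3; first exact: evolution3_dim.
  - exact: e1_neq0.
  - apply/negP => /vlineP[r uE].
    have [|_ /eqP] := @plane_free (- r) 1; last by rewrite oner_eq0.
    by rewrite scaleNr scale1r uE addNr.
  - rewrite -(span_seq1 u) -span_cons rpredBr ?subvsP ?e2_notin_plane //.
case=> [|[|[|//]]] [|[|[|//]]] //= _ _ _.
- by rewrite amulE o12 o13 addr0.
- by rewrite mC wS.
- by rewrite mC amulE o12 o13 addr0.
- by rewrite mC wS.
- by rewrite wS.
- by rewrite wS.
Qed.

Lemma subalg_evolution : is_evolution (subalg S).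
Proof.
have [e1S uS] := mem_plane; pose X0 : subalg S := Subvs e1S; pose X1 : subalg S := Subvs uS.
have [o12 o13 _] := evolution3_orth.
have vsval_mul := subalg_mulE mul_in_socle.
exists [:: X0; X1]; split.
  rewrite basisEdim dim_subalg dim_plane leqnn andbT.
  apply/subvP => v _; have [a [b vE]] := plane_split (subvsP v).
  have -> : v = a *: X0 + b *: X1 by apply: subvs_inj; rewrite vE linearP linearZ.
  by rewrite !span_cons memv_add ?memvZ ?memv_line // addvC span_nil add0v memv_line.
by case=> [|[|//]] [|[|//]] //= _ _ _; apply: subvs_inj;
  rewrite vsval_mul /= ?[u ** e1]mC amulDr o12 o13 addr0.
Qed.

Lemma subalg_product_neq0 : exists v w : subalg S, v ** w <> 0.
Proof.
have [e1S _] := mem_plane; have [sq1 _ _] := square_neq0.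
exists (Subvs e1S), (Subvs e1S) => /(congr1 vsval).
by rewrite (subalg_mulE mul_in_socle) /= => /eqP; rewrite (negPf sq1).
Qed.

Lemma socle_adjunction : exists (phi : 'End(subalg S)) (b0 : subalg S),
  [/\ exists f : 'Hom(A, Adj2 phi b0 0),
        alg_iso f /\ forall b : subalg S, f (vsval b) = (b, 0),
      no_invariant_ideal phi & not_left_mul phi].
Proof.
have dimA : \dim {:A} = (\dim S).+1 by rewrite evolution3_dim dim_plane.
have [phi [b0 [phiV fI]]] := codim1_adj2 mC mul_in_socle e2_notin_plane dimA.
exists phi, b0; split=> //; last exact: socle_not_left_mul.
exact: (minimal_no_invariant_ideal mC mul_in_socle e2_notin_plane dimA phiV socle_minimal).
Qed.

End Socle.

(** * The classification *)

(** Carries phi and b0 along an isomorphism h by conjugation; the invariant ideals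
    correspond under preimage by h. *)
Lemma admissible_transport (K : fieldType) (B B' : algebra K)
    (phi : 'End(B')) (b0 : B') :
    (forall a b : B, a ** b = b ** a) -> isomorphic B' B ->
    no_invariant_ideal phi -> not_left_mul phi ->
  exists2 x : 'End(B) * B, admissible x & isomorphic (Adj2 phi b0 0) (Adj2_0 x).
Proof.
move=> mC [h hI] simple_phi notL.
have [g _ [hK gK]] := alg_iso_inv hI; have hM := hI.2.
pose psi : 'End(B) := (h \o phi \o g)%VF.
have psiE c : psi (h c) = h (phi c) by rewrite !comp_lfunE hK.
exists (psi, h b0); last first.
  have [||f [fI _]] := 
    adj2_iso (phi := phi) (b0 := b0) (psi := psi) (c0 := h b0) (d := 0) (k := 1)
      mC hI (oner_neq0 K).
  - by move=> c; rewrite amul0l add0r scale1r psiE.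
  - by rewrite amul0l linear0 scaler0 expr1n !add0r scale1r.
  by exists f.
split=> [J idJ psiJ | [b /= psib]] /=.
  have [||J'E|J'E] := simple_phi (h @^-1: J)%VS.
  - by move=> a c; rewrite -!memv_preim !hM => /(idJ (h a)).
  - apply/subvP => _ /memv_imgP[c cJ ->]; rewrite -memv_preim -psiE.
    by apply: (subvP psiJ); apply: memv_img; rewrite memv_preim.
  - left; apply/eqP; rewrite -subv0; apply/subvP => v vJ.
    have /eqP gv0 : g v == 0 by rewrite -memv0 -J'E -memv_preim gK.
    by rewrite -[v]gK gv0 linear0 mem0v.
  - right; apply/eqP; rewrite eqEsubv subvf; apply/subvP => v _.
    by rewrite -[v]gK memv_preim J'E memvf.
apply: notL; exists (g b); apply/lfunP => c.
by rewrite lmulE; apply: (can_inj hK); rewrite hM gK -psiE psib lmulE.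
Qed.

Theorem theorem6p13 (K : fieldType) (A : algebra K) (e1 e2 e3 : A) :
  let S := <<[:: e1; (e2 + e3)%R]>>%VS in
  let B := subalg S in
  natural_basis fullv [:: e1; e2; e3] ->
  non_degenerate A ->
  is_Soc S ->
  ~ extension_property S ->
  indecomposable A ->
  (* (1), (2), (3) *)
  (is_evolution B /\
   exists (phi : 'End(B)) (b0 : B),
     [/\ (exists f : 'Hom(A, Adj2 phi b0 0),
            alg_iso f /\ forall b : B, f (vsval b) = (b, 0)),
         minimal_ideal S,
         no_invariant_ideal phi
       & not_left_mul phi])
  /\
  (* the moduli set of the class of A *)
  ((forall A' : algebra K, socle_class B A' ->
      exists2 x : 'End(B) * B, admissible x & isomorphic A' (Adj2_0 x))
   /\
   (forall x y : 'End(B) * B, admissible x ->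
      (isomorphic (Adj2_0 x) (Adj2_0 y) <-> same_orbit x y)))
  /\
  (* isomorphism classes of all Adj2 B phi b0 0 and orbits in End(B) x B *)
  ((forall x y : 'End(B) * B,
      (exists f : 'Hom(Adj2_0 x, Adj2_0 y), alg_iso f /\ preserves_B f)
      <-> same_orbit x y)
   /\
   (not_imperfect_char2 K ->
    forall x y : 'End(B) * B,
      isomorphic (Adj2_0 x) (Adj2_0 y) <-> same_orbit x y)).
Proof.
move=> S B nb nd SocS next ind.
have mC : forall a b : B, a ** b = b ** a.
  by have [X nX] := subalg_evolution nb SocS; apply: natural_basis_commutative nX.
have B2 : exists v w : B, v ** w <> 0 := subalg_product_neq0 nb nd SocS.
have dB : \dim {:B} = 2%N by rewrite dim_subalg (dim_plane nb).
have orbit_isomorphic (x y : 'End(B) * B) : same_orbit x y -> isomorphic (Adj2_0 x) (Adj2_0 y).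
  by move=> xy; have [f [fI _]] := orbit_iso mC xy; exists f.
split; [split | split; split].
- exact: (subalg_evolution nb SocS).
- have [phi [b0 [fI simple_phi notL]]] := socle_adjunction nb nd SocS ind next.
  by exists phi, b0; split=> //; apply: (socle_minimal nb nd SocS ind).
- move=> A' [f1 [f2 [f3 [nb' nd' SocS' next' [ind' isoB]]]]].
  have [phi [b0 [[f [fI _]] simple_phi notL]]] :=
    socle_adjunction nb' nd' SocS' ind' next'.
  have [x ax xI] := admissible_transport b0 mC isoB simple_phi notL.
  by exists x => //; apply: isomorphic_trans xI; exists f.
- move=> x y [simple_x _]; split; last exact: orbit_isomorphic.
  by move=> [f fI]; apply: (iso_orbit mC fI); apply: (admissible_preserves B2 simple_x fI).
- move=> x y; split; last exact: (orbit_iso mC).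
  by move=> [f [fI fB]]; apply: (iso_orbit mC fI fB).
- move=> perf x y; split; last exact: orbit_isomorphic.
  by move=> [f fI]; apply: (iso_same_orbit mC perf dB B2 fI).
Qed.
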